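(* Let $H$ be a weak Hopf algebra, $C$ a coalgebra, and let $C^*$ be a right partial $H$-module algebra via $\leftharpoonup:C^*\otimes H\to C^*$, $\alpha\otimes h\mapsto(\alpha\leftharpoonup h)$. Then $C$ is a left partial $H$-module coalgebra via a linear map $\cdot:H\otimes C\to C$, $h\otimes c\mapsto h\cdot c$, such that $(\alpha\leftharpoonup h)(c)=\alpha(h\cdot c)$ for all $\alpha\in C^*$, $h\in H$ and $c\in C$. Moreover, if $C^*$ is a symmetric right partial $H$-module algebra, then $C$ is a symmetric left partial $H$-module coalgebra.
   Context: Everything is over a fixed field $\Bbbk$; Sweedler notation $\Delta(x)=x_1\otimes x_2$ is used. $C^*=\mathrm{Hom}(C,\Bbbk)$ is an algebra under convolution $(\alpha\beta)(c)=\alpha(c_1)\beta(c_2)$ with unit $1_{C^*}=\varepsilon$, the counit of $C$. Weak Hopf algebra: a vector space $H$ that is an algebra and a coalgebra with $\Delta(hk)=\Delta(h)\Delta(k)$; $\varepsilon(hk\ell)=\varepsilon(hk_1)\varepsilon(k_2\ell)=\varepsilon(hk_2)\varepsilon(k_1\ell)$; $(1_H\otimes\Delta(1_H))(\Delta(1_H)\otimes1_H)=(\Delta(1_H)\otimes1_H)(1_H\otimes\Delta(1_H))=\Delta^2(1_H)$; together with a linear antipode $S:H\to H$ with $h_1S(h_2)=\varepsilon_t(h)$, $S(h_1)h_2=\varepsilon_s(h)$, $S(h_1)h_2S(h_3)=S(h)$, where $\varepsilon_t(h)=\varepsilon(1_1h)1_2$, $\varepsilon_s(h)=1_1\varepsilon(h1_2)$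 and $1_1\otimes1_2=\Delta(1_H)$. Left partial $H$-module coalgebra: a coalgebra $C$ with a linear map $\cdot:H\otimes C\to C$ such that for all $h,k\in H$, $c\in C$: $1_H\cdot c=c$; $\Delta(h\cdot c)=h_1\cdot c_1\otimes h_2\cdot c_2$; $h\cdot(k\cdot c)=(hk_1\cdot c_1)\,\varepsilon(k_2\cdot c_2)$. It is symmetric if moreover $h\cdot(k\cdot c)=\varepsilon(k_1\cdot c_1)\,(hk_2\cdot c_2)$. Right partial $H$-module algebra: an algebra $A$ with a linear map $\leftharpoonup:A\otimes H\to A$ such that for all $h,k\in H$, $a,b\in A$: $a\leftharpoonup1_H=a$; $ab\leftharpoonup h=(a\leftharpoonup h_1)(b\leftharpoonup h_2)$; $(a\leftharpoonup h)\leftharpoonup k=(a\leftharpoonup hk_1)(1_A\leftharpoonup k_2)$. It is symmetric if moreover $(a\leftharpoonup h)\leftharpoonup k=(1_A\leftharpoonup k_1)(a\leftharpoonup hk_2)$.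
   Formalization: Added hypothesis: for all h in H and c in C, the functional α ↦ (α↼h)(c) on C* is evaluation at some element of C; this is automatic when C is finite-dimensional, and without it the claim fails for some infinite-dimensional C. *)

(* Defs.v *)
From HB Require Import structures.
From mathcomp Require Import all_boot all_order all_algebra.
From mathcomp Require Import boolp.

Set Implicit Arguments.
Unset Strict Implicit.
Unset Printing Implicit Defensive.

Import GRing.Theory.
Local Open Scope ring_scope.
Local Open Scope quotient_scope.

(** * Tensor products of vector spaces of arbitrary dimension *)

(* A list [:: (u_1, v_1); ...; (u_n, v_n)] stands for the sum of the
   u_i (x) v_i.  Two lists are identified when every bilinear map takes the same
   value on both; this is the quotient characterized by the universal property
   ([tlift_linear], [tlift_pair] and [tlift_unique] below). *)
Section TensorProduct.
Variables (k : fieldType) (U V : lmodType k).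
Implicit Types (s t : seq (U * V)).

Definition ev_list (W : lmodType k) (f : U -> V -> W) s : W :=
  \sum_(p <- s) f p.1 p.2.

Definition tens_eq s t : bool :=
  `[< forall (W : lmodType k) (f : {bilinear U -> V -> W}),
        ev_list f s = ev_list f t >].

Lemma tens_eq_refl : reflexive tens_eq.
Proof. by move=> s; apply/asboolP. Qed.

Lemma tens_eq_sym : symmetric tens_eq.
Proof.
by move=> s t; apply/asboolP/asboolP => h W f; rewrite h.
Qed.

Lemma tens_eq_trans : transitive tens_eq.
Proof.
move=> t s r /asboolP h1 /asboolP h2; apply/asboolP => W f.
by rewrite h1 h2.
Qed.

Canonical tens_equiv := EquivRel tens_eq tens_eq_refl tens_eq_sym tens_eq_trans.

Definition tens : Type := {eq_quot tens_equiv}.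
HB.instance Definition _ := Choice.on tens.
HB.instance Definition _ := EqQuotient.on tens.

Lemma ev_list_cat (W : lmodType k) (f : U -> V -> W) s t :
  ev_list f (s ++ t) = ev_list f s + ev_list f t.
Proof. exact: big_cat. Qed.

Lemma ev_list_scale (W : lmodType k) (f : {bilinear U -> V -> W}) (a : k) s :
  ev_list f [seq (a *: p.1, p.2) | p <- s] = a *: ev_list f s.
Proof.
rewrite /ev_list big_map scaler_sumr; apply: eq_bigr => p _ /=.
exact: linearZl_LR.
Qed.

Lemma tens_piP s t :
  (\pi_tens s = \pi_tens t) <->
  (forall (W : lmodType k) (f : {bilinear U -> V -> W}),
     ev_list f s = ev_list f t).
Proof.
split=> [/eqmodP/asboolP // | h]; by apply/eqmodP/asboolP.
Qed.

Lemma ev_repr (W : lmodType k) (f : {bilinear U -> V -> W}) s :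
  ev_list f (repr (\pi_tens s)) = ev_list f s.
Proof.
by have /tens_piP h : \pi_tens (repr (\pi_tens s)) = \pi_tens s by rewrite reprK.
Qed.

Definition tens_scale (a : k) (x : tens) : tens :=
  \pi_tens [seq (a *: p.1, p.2) | p <- repr x].
Definition tens_add (x y : tens) : tens := \pi_tens (repr x ++ repr y).
Definition tens_opp (x : tens) : tens := tens_scale (-1) x.
Definition tens_zero : tens := \pi_tens [::].

Lemma tensP (x y : tens) :
  (forall (W : lmodType k) (f : {bilinear U -> V -> W}),
     ev_list f (repr x) = ev_list f (repr y)) -> x = y.
Proof.
by move=> h; rewrite -(reprK x) -(reprK y); apply/tens_piP => W f; exact: h.
Qed.

Let evD (W : lmodType k) (f : {bilinear U -> V -> W}) x y :
  ev_list f (repr (tens_add x y)) = ev_list f (repr x) + ev_list f (repr y).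
Proof. by rewrite ev_repr ev_list_cat. Qed.

Let evZ (W : lmodType k) (f : {bilinear U -> V -> W}) a x :
  ev_list f (repr (tens_scale a x)) = a *: ev_list f (repr x).
Proof. by rewrite ev_repr ev_list_scale. Qed.

Let ev0 (W : lmodType k) (f : {bilinear U -> V -> W}) :
  ev_list f (repr tens_zero) = 0.
Proof. by rewrite ev_repr /ev_list big_nil. Qed.

Let tens_addA : associative tens_add.
Proof. by move=> x y z; apply: tensP => W f; rewrite !evD addrA. Qed.
Let tens_addC : commutative tens_add.
Proof. by move=> x y; apply: tensP => W f; rewrite !evD addrC. Qed.
Let tens_add0 : left_id tens_zero tens_add.
Proof. by move=> x; apply: tensP => W f; rewrite evD ev0 add0r. Qed.
Let tens_addN : left_inverse tens_zero tens_opp tens_add.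
Proof.
by move=> x; apply: tensP => W f; rewrite evD evZ ev0 scaleN1r addNr.
Qed.

HB.instance Definition _ :=
  GRing.isZmodule.Build tens tens_addA tens_addC tens_add0 tens_addN.

Let tens_scaleA a b x : tens_scale a (tens_scale b x) = tens_scale (a * b) x.
Proof. by apply: tensP => W f; rewrite !evZ scalerA. Qed.
Let tens_scale1 : left_id 1 tens_scale.
Proof. by move=> x; apply: tensP => W f; rewrite evZ scale1r. Qed.
Let tens_scaleDr : right_distributive tens_scale +%R.
Proof. by move=> a x y; apply: tensP => W f; rewrite !(evZ, evD) scalerDr. Qed.
Let tens_scaleDl x : {morph tens_scale^~ x : a b / a + b}.
Proof. by move=> a b; apply: tensP => W f; rewrite !(evZ, evD) scalerDl. Qed.

HB.instance Definition _ := GRing.Zmodule_isLmodule.Build k tens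
  tens_scaleA tens_scale1 tens_scaleDr tens_scaleDl.

Definition tpair (u : U) (v : V) : tens := \pi_tens [:: (u, v)].

(* The linear map U (x) V -> W induced by a bilinear f, written with the tensor
   first so that, for x = \sum u_i (x) v_i, [tlift x (fun u v => E u v)] reads as
   the Sweedler-type sum \sum E(u_i, v_i).  It is meaningful only for E bilinear
   (it does not then depend on the chosen representative, see [tens_piP]). *)
Definition tlift (W : lmodType k) (x : tens) (f : U -> V -> W) : W :=
  ev_list f (repr x).

Lemma tlift_linear (W : lmodType k) (f : U -> V -> W) :
  bilinear_for *:%R *:%R f -> linear (fun x => tlift x f).
Proof.
move=> hf; pose g : {bilinear U -> V -> W} :=
  HB.pack f (bilinear_isBilinear.Build k U V W *:%R *:%R f hf).
move=> a x y; rewrite -[f]/(g : U -> V -> W) /tlift.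
by rewrite -[_ + y]/(tens_add (tens_scale a x) y) evD evZ.
Qed.

Lemma tlift_pair (W : lmodType k) (f : U -> V -> W) u v :
  bilinear_for *:%R *:%R f -> tlift (tpair u v) f = f u v.
Proof.
move=> hf; pose g : {bilinear U -> V -> W} :=
  HB.pack f (bilinear_isBilinear.Build k U V W *:%R *:%R f hf).
by rewrite -[f]/(g : U -> V -> W) /tlift ev_repr /ev_list big_seq1.
Qed.

Lemma eq_tlift (W : lmodType k) (f g : U -> V -> W) x :
  (forall u v, f u v = g u v) -> tlift x f = tlift x g.
Proof. by move=> fg; apply: eq_bigr => p _; exact: fg. Qed.

Lemma linear_tlift (W W' : lmodType k) (F : {linear W -> W'})
    (f : U -> V -> W) x :
  F (tlift x f) = tlift x (fun u v => F (f u v)).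
Proof. by rewrite /tlift /ev_list linear_sum. Qed.

Lemma tpair_is_bilinear : bilinear_for *:%R *:%R tpair.
Proof.
by split=> w a u v; apply: tensP => W f;
  rewrite -[in RHS]/(tens_add (tens_scale _ _) _) evD evZ !ev_repr
          /ev_list !big_seq1 /= ?linearPl ?linearPr.
Qed.
HB.instance Definition _ :=
  bilinear_isBilinear.Build k U V tens *:%R *:%R tpair tpair_is_bilinear.

Lemma tens_sum (x : tens) : x = \sum_(p <- repr x) tpair p.1 p.2.
Proof.
rewrite -[LHS]reprK; elim: (repr x) => [|[u v] s IHs]; first by rewrite big_nil.
rewrite big_cons -IHs /=; apply: tensP => W f.
by rewrite -[_ + _]/(tens_add _ _) evD !ev_repr /ev_list big_cons big_seq1.
Qed.

Lemma tlift_unique (W : lmodType k) (g h : {linear tens -> W}) :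
  (forall u v, g (tpair u v) = h (tpair u v)) -> g =1 h.
Proof.
move=> gh x; rewrite (tens_sum x) !linear_sum; apply: eq_bigr => p _.
exact: gh.
Qed.

End TensorProduct.

Notation "u '\ox' v" := (tpair u v) (at level 39, left associativity) : ring_scope.

(** * Algebras, coalgebras and weak Hopf algebras *)

(* Unital associative algebras over k, with 1 = 0 allowed: [algType] imposes
   1 != 0, which fails for the dual of the zero coalgebra. *)
HB.mixin Record isUAlgebra (k : fieldType) A of GRing.Lmodule k A := {
  aone : A;
  amul : A -> A -> A;
  amul_bilinear : bilinear_for *:%R *:%R amul;
  amulA : associative amul;
  amul1l : left_id aone amul;
  amul1r : right_id aone amul
}.

#[short(type="ualgType")]
HB.structure Definition UAlgebra (k : fieldType) :=
  {A of GRing.Lmodule k A & isUAlgebra k A}.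

Notation "x ** y" := (amul x y) (at level 40, left associativity) : ring_scope.

HB.mixin Record isCoalgebra (k : fieldType) C of GRing.Lmodule k C := {
  comul : {linear C -> tens C C};
  counit : {linear C -> k^o};
  comulA : forall c : C,
    tlift (comul c) (fun c1 c2 =>
      tlift (comul c1) (fun c11 c12 => c11 \ox (c12 \ox c2)))
    = tlift (comul c) (fun c1 c2 => c1 \ox comul c2);
  counitl : forall c : C, tlift (comul c) (fun c1 c2 => (counit c1 : k) *: c2) = c;
  counitr : forall c : C, tlift (comul c) (fun c1 c2 => (counit c2 : k) *: c1) = c
}.

#[short(type="coalgType")]
HB.structure Definition Coalgebra (k : fieldType) :=
  {C of GRing.Lmodule k C & isCoalgebra k C}.

(* The product (u (x) v)(u' (x) v') = mU u u' (x) mV v v' on U (x) V. *)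
Definition tens_mul (k : fieldType) (U V : lmodType k)
    (mU : U -> U -> U) (mV : V -> V -> V) (x y : tens U V) : tens U V :=
  tlift x (fun u v => tlift y (fun u' v' => mU u u' \ox mV v v')).

HB.structure Definition UAlgCoalg (k : fieldType) :=
  {H of UAlgebra k H & Coalgebra k H}.

Section WeakHopfOps.
Variables (k : fieldType) (H : UAlgCoalg.type k).

(* eps_t(h) = eps(1_1 h) 1_2   and   eps_s(h) = 1_1 eps(h 1_2) *)
Definition eps_t (h : H) : H :=
  tlift (comul aone) (fun x y : H => (counit (x ** h) : k) *: y).
Definition eps_s (h : H) : H :=
  tlift (comul aone) (fun x y : H => (counit (h ** y) : k) *: x).

Definition mul2 : tens H H -> tens H H -> tens H H := tens_mul amul amul.
Definition mul3 : tens H (tens H H) -> tens H (tens H H) -> tens H (tens H H) :=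
  tens_mul amul mul2.

(* 1 (x) Delta(1),  Delta(1) (x) 1  and  Delta^2(1), all in H (x) (H (x) H) *)
Definition one_Delta1 : tens H (tens H H) := aone \ox comul aone.
Definition Delta1_one : tens H (tens H H) :=
  tlift (comul aone) (fun x y : H => x \ox (y \ox aone)).
Definition Delta2_one : tens H (tens H H) :=
  tlift (comul aone) (fun x y : H => x \ox comul y).
End WeakHopfOps.

HB.mixin Record isWeakHopf (k : fieldType) H of UAlgCoalg k H := {
  comulM : forall h l : H, comul (h ** l) = mul2 (comul h) (comul l);
  counitM12 : forall h l m : H,
    counit (h ** l ** m)
    = tlift (comul l) (fun l1 l2 => counit (h ** l1) * counit (l2 ** m));
  counitM21 : forall h l m : H,
    counit (h ** l ** m)
    = tlift (comul l) (fun l1 l2 => counit (h ** l2) * counit (l1 ** m));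
  weak_unitl : mul3 (one_Delta1 H) (Delta1_one H) = Delta2_one H;
  weak_unitr : mul3 (Delta1_one H) (one_Delta1 H) = Delta2_one H;
  antipode : {linear H -> H};
  antipode_t : forall h : H,
    tlift (comul h) (fun h1 h2 => h1 ** antipode h2) = eps_t h;
  antipode_s : forall h : H,
    tlift (comul h) (fun h1 h2 => antipode h1 ** h2) = eps_s h;
  antipode_sts : forall h : H,
    tlift (comul h) (fun h1 h' => tlift (comul h') (fun h2 h3 =>
      antipode h1 ** h2 ** antipode h3)) = antipode h
}.

#[short(type="weakHopfType")]
HB.structure Definition WeakHopf (k : fieldType) :=
  {H of UAlgCoalg k H & isWeakHopf k H}.

(** * The dual algebra of a coalgebra *)

Record dual (k : fieldType) (C : lmodType k) :=
  Dual { dual_fun :> {linear C -> k^o} }.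

Section DualSpace.
Variables (k : fieldType) (C : lmodType k).
Implicit Types alpha beta : dual C.

HB.instance Definition _ := gen_eqMixin (dual C).
HB.instance Definition _ := gen_choiceMixin (dual C).

Lemma dualP alpha beta : alpha =1 beta -> alpha = beta.
Proof.
case: alpha beta => [f] [g] /= fg; congr Dual.
move: f g fg => [f cf] [g cg] /= fg.
have e : f = g by apply/funext.
subst g; congr GRing.Linear.Pack.
case: cf => [[a1] [a2]]; case: cg => [[b1] [b2]].
by rewrite (Prop_irrelevance a1 b1) (Prop_irrelevance a2 b2).
Qed.

Definition dual_zero : dual C := Dual (\0 : {linear C -> k^o}).
Definition dual_add alpha beta : dual C :=
  Dual ((alpha \+ beta) : {linear C -> k^o}).
Definition dual_opp alpha : dual C := Dual ((\- alpha) : {linear C -> k^o}).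
Definition dual_scale (a : k) alpha : dual C :=
  Dual ((a \*: alpha) : {linear C -> k^o}).

Let addA : associative dual_add.
Proof. by move=> f g h; apply: dualP => c; exact: addrA. Qed.
Let addC : commutative dual_add.
Proof. by move=> f g; apply: dualP => c; exact: addrC. Qed.
Let add0 : left_id dual_zero dual_add.
Proof. by move=> f; apply: dualP => c; exact: add0r. Qed.
Let addN : left_inverse dual_zero dual_opp dual_add.
Proof. by move=> f; apply: dualP => c; exact: addNr. Qed.
HB.instance Definition _ := GRing.isZmodule.Build (dual C) addA addC add0 addN.

Let scaleA a b f : dual_scale a (dual_scale b f) = dual_scale (a * b) f.
Proof. by apply: dualP => c; exact: scalerA. Qed.
Let scale1 : left_id 1 dual_scale.
Proof. by move=> f; apply: dualP => c; exact: scale1r. Qed.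
Let scaleDr : right_distributive dual_scale +%R.
Proof. by move=> a f g; apply: dualP => c; exact: scalerDr. Qed.
Let scaleDl f : {morph dual_scale^~ f : a b / a + b}.
Proof. by move=> a b; apply: dualP => c; exact: scalerDl. Qed.
HB.instance Definition _ := GRing.Zmodule_isLmodule.Build k (dual C)
  scaleA scale1 scaleDr scaleDl.

Lemma dual_linE (a : k) alpha beta (c : C) :
  (a *: alpha + beta) c = a * alpha c + beta c.
Proof. by []. Qed.

End DualSpace.

Section DualAlgebra.
Variables (k : fieldType) (C : coalgType k).
Implicit Types alpha beta gamma : dual C.

Definition conv_fun alpha beta (c : C) : k^o :=
  tlift (comul c) (fun c1 c2 => alpha c1 * beta c2).

Lemma prod_bilinear (U V : lmodType k)
    (f : {linear U -> k^o}) (g : {linear V -> k^o}) :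
  bilinear_for *:%R *:%R (fun u v => f u * g v : k^o).
Proof.
split=> w a u v /=; rewrite linearP.
  by rewrite mulrDl scalerAl.
by rewrite mulrDr -scalerAr.
Qed.

Lemma conv_is_linear alpha beta : linear (conv_fun alpha beta).
Proof.
move=> a x y; rewrite /conv_fun linearP; apply: tlift_linear.
exact: prod_bilinear.
Qed.

HB.instance Definition _ alpha beta :=
  GRing.isLinear.Build k C k^o *:%R (conv_fun alpha beta)
    (conv_is_linear alpha beta).

Definition conv alpha beta : dual C :=
  Dual (conv_fun alpha beta : {linear C -> k^o}).

Definition dual_one : dual C := Dual counit.

Let conv_bilinear : bilinear_for *:%R *:%R conv.
Proof.
split=> w a f g; apply: dualP => c.
  rewrite [RHS]dual_linE /= /conv_fun /tlift /ev_list mulr_sumr -big_split.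
  apply: eq_bigr => p _; rewrite [X in X * _ = _]dual_linE.
  by rewrite mulrDl mulrA.
rewrite [RHS]dual_linE /= /conv_fun /tlift /ev_list mulr_sumr -big_split.
apply: eq_bigr => p _; rewrite [X in _ * X = _]dual_linE.
by rewrite mulrDr mulrCA.
Qed.

Let convA : associative conv.
Proof.
move=> f g h; apply: dualP => c /=; rewrite /conv_fun /=.
pose B1 := fun y z : C => g y * h z : k^o.
pose F2 (t : tens C C) : k^o := tlift t B1.
have lin2 : linear F2 by apply: tlift_linear; apply: prod_bilinear.
pose F2l : {linear tens C C -> k^o} :=
  HB.pack F2 (GRing.isLinear.Build k (tens C C) k^o *:%R F2 lin2).
pose B := fun (x : C) (t : tens C C) => f x * F2l t : k^o.
have hB : bilinear_for *:%R *:%R B by apply: prod_bilinear.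
pose F (t : tens C (tens C C)) : k^o := tlift t B.
have lin : linear F by apply: tlift_linear.
pose Fl : {linear tens C (tens C C) -> k^o} :=
  HB.pack F (GRing.isLinear.Build k _ k^o *:%R F lin).
have := congr1 Fl (comulA c); rewrite !linear_tlift.
have e1 x t : Fl (x \ox t) = B x t by exact: tlift_pair.
have e2 x y : F2l (x \ox y) = B1 x y.
  by apply: tlift_pair; apply: prod_bilinear.
under [in RHS]eq_tlift do rewrite e1.
under [in LHS]eq_tlift do rewrite linear_tlift.
move=> e; rewrite -[LHS]/(tlift (comul c) (fun c1 c2 => B c1 (comul c2))) -e.
apply: eq_tlift => x y; rewrite /tlift /ev_list mulr_suml.
by apply: eq_bigr => p _; rewrite e1 /B e2 /B1 mulrA.
Qed.

Let conv1l : left_id dual_one conv.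
Proof.
move=> f; apply: dualP => c /=; rewrite /conv_fun -[in RHS](counitl c).
rewrite linear_tlift; apply: eq_tlift => x y /=.
by rewrite linearZ.
Qed.

Let conv1r : right_id dual_one conv.
Proof.
move=> f; apply: dualP => c /=; rewrite /conv_fun -[in RHS](counitr c).
rewrite linear_tlift; apply: eq_tlift => x y /=.
by rewrite linearZ mulrC.
Qed.

HB.instance Definition _ :=
  isUAlgebra.Build k (dual C) conv_bilinear convA conv1l conv1r.

End DualAlgebra.

(** * Partial actions *)

Section PartialActions.
Variables (k : fieldType) (H : weakHopfType k).

Section LeftCoalgebra.
Variables (C : coalgType k) (act : {linear tens H C -> C}).
Local Notation "h '\act' c" := (act (h \ox c)) (at level 38, right associativity).

Definition left_partial_module_coalgebra : Prop :=
  [/\ forall c : C, aone \act c = c,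
      forall (h : H) (c : C),
        comul (h \act c)
        = tlift (comul h) (fun h1 h2 => tlift (comul c) (fun c1 c2 =>
            (h1 \act c1) \ox (h2 \act c2)))
    & forall (h l : H) (c : C),
        h \act (l \act c)
        = tlift (comul l) (fun l1 l2 => tlift (comul c) (fun c1 c2 =>
            (counit (l2 \act c2) : k) *: ((h ** l1) \act c1)))].

Definition symmetric_left_partial_module_coalgebra : Prop :=
  left_partial_module_coalgebra /\
  forall (h l : H) (c : C),
    h \act (l \act c)
    = tlift (comul l) (fun l1 l2 => tlift (comul c) (fun c1 c2 =>
        (counit (l1 \act c1) : k) *: ((h ** l2) \act c2))).
End LeftCoalgebra.

Section RightAlgebra.
Variables (A : ualgType k) (ract : {linear tens A H -> A}).
Local Notation "a '\ract' h" := (ract (a \ox h)) (at level 38, left associativity).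

Definition right_partial_module_algebra : Prop :=
  [/\ forall a : A, a \ract aone = a,
      forall (a b : A) (h : H),
        (a ** b) \ract h
        = tlift (comul h) (fun h1 h2 => (a \ract h1) ** (b \ract h2))
    & forall (a : A) (h l : H),
        a \ract h \ract l
        = tlift (comul l) (fun l1 l2 =>
            (a \ract (h ** l1)) ** (aone \ract l2))].

Definition symmetric_right_partial_module_algebra : Prop :=
  right_partial_module_algebra /\
  forall (a : A) (h l : H),
    a \ract h \ract l
    = tlift (comul l) (fun l1 l2 =>
        (aone \ract l1) ** (a \ract (h ** l2))).
End RightAlgebra.

End PartialActions.

(* [acts_by_transposes ract] says that every functional alpha |-> (alpha . h)(c)
   on C^* is the evaluation at an element of C, i.e. that each map alpha |-> alpha . h
   is the transpose of a map C -> C.  It is necessary for a map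
   H (x) C -> C dual to ract to exist.  It is automatic when C has finite dimension
   ([acts_by_transposes_finite]) and can fail otherwise, even for a global
   action: let C = k + V with V infinite-dimensional and primitive, so that
   C^* = k + V^* with V^* V^* = 0; pick phi <> 0 in V^** vanishing on the
   finitely supported elements of V^* (for some basis of V) and u <> 0 finitely
   supported; then f |-> f + phi(f) u is an automorphism of the algebra C^*
   (hence gives an action of the group algebra of the integers), but not a
   transpose. *)
Definition acts_by_transposes (k : fieldType) (H : weakHopfType k)
    (C : coalgType k) (ract : {linear tens (dual C) H -> dual C}) : Prop :=
  forall (h : H) (c : C), exists d : C,
    forall alpha : dual C, ract (alpha \ox h) c = alpha d.

Lemma acts_by_transposes_finite (k : fieldType) (H : weakHopfType k)
    (C : coalgType k) (ract : {linear tens (dual C) H -> dual C})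
    (n : nat) (e : 'I_n -> C) (e' : 'I_n -> dual C) :
  (forall c : C, c = \sum_i (e' i c : k) *: e i) ->
  acts_by_transposes ract.
Proof.
move=> basis_e h c; exists (\sum_i (ract (e' i \ox h) c : k) *: e i) => alpha.
have ev0 : (0 : dual C) c = 0 by [].
have sumE (F : 'I_n -> dual C) x : (\sum_i F i) x = \sum_i F i x.
  by apply: (big_morph (fun f : dual C => f x)).
have alphaE : alpha = \sum_i (alpha (e i) : k) *: e' i.
  apply: dualP => x; rewrite [in LHS](basis_e x) linear_sum sumE.
  apply: eq_bigr => i _; rewrite linearZ; exact: mulrC.
have sumox (F : 'I_n -> dual C) : (\sum_i F i) \ox h = \sum_i (F i \ox h).
  by rewrite linear_sumlz.
rewrite [in LHS]alphaE sumox linear_sum sumE linear_sum.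
apply: eq_bigr => i _; rewrite linearZl_LR /= !linearZ; exact: mulrC.
Qed.

(* Main.v *)
(* By Zorn's lemma the functionals in C^* separate the points of C, and the
   products of two functionals separate the points of C (x) C.  Hence the element
   h . c with (alpha <- h)(c) = alpha(h . c) is unique and depends bilinearly on h
   and c, and each axiom of the action on C, tested against functionals, becomes
   the corresponding axiom of the action on C^*. *)
Require Import Defs.
From HB Require Import structures.
From mathcomp Require Import all_boot all_order all_algebra.
From mathcomp Require Import boolp classical_sets.

Import GRing.Theory.
Local Open Scope ring_scope.

(** * Separation of points by functionals, on vector spaces and tensor products *)

Section Separation.
Set Implicit Arguments.
Unset Strict Implicit.
Context (k : fieldType).

Definition subspace (V : lmodType k) (W : set V) : Prop :=
  W 0 /\ forall (a : k) x y, W x -> W y -> W (a *: x + y).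

Lemma subspaceD (V : lmodType k) (W : set V) x y :
  subspace W -> W x -> W y -> W (x + y).
Proof. by case=> _ WL Wx Wy; rewrite -[x]scale1r; apply: WL. Qed.

Lemma subspaceZ (V : lmodType k) (W : set V) a x :
  subspace W -> W x -> W (a *: x).
Proof. by case=> W0 WL Wx; rewrite -[_ *: _]addr0; apply: WL. Qed.

Lemma subspaceB (V : lmodType k) (W : set V) x y :
  subspace W -> W x -> W y -> W (x - y).
Proof.
by move=> sW Wx Wy; rewrite -scaleN1r; apply: subspaceD => //; apply: subspaceZ.
Qed.

(** Take [W] maximal among the subspaces that contain [W0] and avoid [c]. Any [x] outside [W] has
    [c] in [W + k x]; the coefficient of [x] there is nonzero and can be inverted. So [V] is the
    direct sum of [W] and the line [k c]. *)
Lemma maximal_subspace_avoiding (V : lmodType k) (W0 : set V) (c : V) :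
  subspace W0 -> ~ W0 c ->
  exists W : set V, [/\ subspace W, (W0 `<=` W)%classic, ~ W c
    & forall x, exists a : k, W (x - a *: c)].
Proof.
move=> sW0 W0c.
(* The empty set must satisfy P, as Zorn_bigcup includes the empty chain. *)
pose P (A : set V) := [/\ forall (a : k) x y, A x -> A y -> A (a *: x + y),
  ~ A c & forall x, A x -> (W0 `<=` A)%classic].
have [F FP Ftot|W [[WL Wc WW0] Wmax]] := @Zorn_bigcup V P.
  split.
  - move=> a x y [X FX Xx] [Y FY Yy].
    have [XY|YX] := Ftot _ _ FX FY.
      by exists Y => //; have [YL _ _] := FP _ FY; apply: YL => //; apply: XY.
    by exists X => //; have [XL _ _] := FP _ FX; apply: XL => //; apply: YX.
  - by move=> [X FX Xc]; have [_ /(_ Xc)] := FP _ FX.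
  - move=> x [X FX Xx] w W0w; exists X => //.
    by have [_ _ /(_ _ Xx)] := FP _ FX; apply.
(* If [W] missed 0 it would be empty, and [W0] would be a larger set satisfying [P]. *)
have W00 : W 0.
  apply: contrapT => nW0; apply: (Wmax W0).
    split=> [x Wx|/(_ 0 (proj1 sW0))//].
    by case: nW0; apply: (WW0 x Wx); case: sW0.
  by rewrite /P; case: sW0 => _ W0L; split=> // x _ y.
have sW : subspace W by [].
have W0W := WW0 _ W00.
exists W; split=> // x.
have [Wx|nWx] := pselect (W x); first by exists 0; rewrite scale0r subr0.
(* [Wx] is the subspace [W + k x]. *)
pose Wx : set V := fun y => exists b : k, W (y - b *: x).
have WWx : (W `<=` Wx)%classic.
  by move=> y Wy; exists 0; rewrite scale0r subr0.
have [b Wb] : Wx c.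
  apply: contrapT => nWxc; apply: (Wmax Wx).
    split=> // /(_ x) WxW; apply: nWx; apply: WxW.
    by exists 1; rewrite scale1r subrr.
  split=> // [a y z [b Wy] [b' Wz]|_ _]; last exact: subset_trans WWx.
  exists (a * b + b').
  rewrite (_ : _ - _ = a *: (y - b *: x) + (z - b' *: x)); first exact: WL.
  by rewrite scalerBr scalerDl scalerA opprD addrACA.
have b0 : b != 0.
  by apply/eqP => b0; apply: Wc; rewrite b0 scale0r subr0 in Wb.
exists b^-1; rewrite (_ : _ - _ = - b^-1 *: (c - b *: x)).
  exact: subspaceZ.
by rewrite scalerBr !scaleNr opprK scalerA mulVf // scale1r addrC.
Qed.

(** The functional is the coordinate along [c] modulo a complement [W] of [k c] containing [W0].
    This coordinate is unique since [c] is not in [W], which yields linearity and both values. *)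
Lemma functional_extending_subspace (V : lmodType k) (W0 : set V) (c : V) :
  subspace W0 -> ~ W0 c ->
  exists f : dual V, (forall w, W0 w -> f w = 0) /\ f c = 1.
Proof.
move=> sW0 /(maximal_subspace_avoiding sW0) [W [sW W0W Wc coef]].
pose f x : k^o := projT1 (cid (coef x)).
have fP x : W (x - f x *: c) by rewrite /f; case: cid.
have f_uniq x (a : k) : W (x - a *: c) -> f x = a.
  move=> Wa; apply: contrapT => /eqP ne; apply: Wc.
  have ba : f x - a != 0 by rewrite subr_eq0.
  rewrite (_ : c = (f x - a)^-1 *: ((x - a *: c) - (x - f x *: c))).
    by apply: subspaceZ => //; apply: subspaceB.
  by rewrite opprB [X in _ *: X]addrC addrA subrK -scalerBl scalerA mulVf // scale1r.
have f_lin : linear f.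
  move=> a x y; apply: f_uniq.
  rewrite (_ : _ - _ = a *: (x - f x *: c) + (y - f y *: c)).
    by case: (sW) => _; apply.
  by rewrite scalerBr scalerDl scalerA opprD addrACA.
exists (Dual (HB.pack f (GRing.isLinear.Build k V k^o *:%R f f_lin))).
split=> [w /W0W Ww|] /=; apply: f_uniq; first by rewrite scale0r subr0.
by rewrite scale1r subrr; case: sW.
Qed.

Lemma dual_separates (V : lmodType k) (x y : V) :
  (forall f : dual V, f x = f y) -> x = y.
Proof.
move=> fxy; apply: contrapT => /eqP; rewrite -subr_eq0 => /eqP ne.
have [||f [_ /eqP]] := @functional_extending_subspace V (fun z => z = 0) (x - y).
- by split=> // a u v -> ->; rewrite scaler0 addr0.
- by [].
by rewrite linearB /= fxy subrr eq_sym oner_eq0.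
Qed.

Fixpoint lspan (V : lmodType k) (s : seq V) : set V :=
  if s is v :: s' then fun x => exists a : k, lspan s' (x - a *: v)
  else fun x => x = 0.

Lemma lspan_subspace (V : lmodType k) (s : seq V) : subspace (lspan s).
Proof.
elim: s => [|v s [IH0 IHL]] /=.
  by split=> // a u w -> ->; rewrite scaler0 addr0.
split=> [|a x y [b xb] [d yd]]; first by exists 0; rewrite scale0r subr0.
exists (a * b + d).
rewrite (_ : _ - _ = a *: (x - b *: v) + (y - d *: v)); first exact: IHL.
by rewrite scalerBr scalerDl scalerA opprD addrACA.
Qed.

Lemma mem_lspan (V : lmodType k) (s : seq V) v : v \in s -> lspan s v.
Proof.
elim: s => [//|w s IHs]; rewrite inE => /predU1P[->|/IHs vs] /=.
  by exists 1; rewrite scale1r subrr; case: (lspan_subspace s).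
by exists 0; rewrite scale0r subr0.
Qed.


(** If [v] is the sum of the [a_i v_i], add [a_i u] to each [u_i]. The list [s'] does not depend on
    [f]: it serves both for [tpair] and for the slice maps. *)
Lemma ev_list_absorb (U V : lmodType k) (s : seq (U * V)) u v :
  lspan [seq p.2 | p <- s] v ->
  exists s', size s' = size s /\
    forall (W : lmodType k) (f : {bilinear U -> V -> W}),
      f u v + ev_list f s = ev_list f s'.
Proof.
elim: s v => [v ->|[u1 v1] s IHs v /= [a /IHs[s' [sz fs']]]].
  by exists [::]; split=> // W f; rewrite linear0r add0r.
exists ((u1 + a *: u, v1) :: s'); split=> [|W f]; first by rewrite /= sz.
rewrite /ev_list !big_cons -/(ev_list f s) -/(ev_list f s') -fs' /=.
rewrite linearBr linearZr_LR linearDl linearZl_LR /=.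
by rewrite [f u v - _]addrC -!addrA addNKr addrCA.
Qed.

Lemma slice_bilinear (U V : lmodType k) (g : dual V) :
  bilinear_for *:%R *:%R (fun (u : U) (v : V) => (g v : k) *: u).
Proof.
split=> w a u v /=; first by rewrite scalerDr !scalerA mulrC.
by rewrite linearP scalerDl -scalerA.
Qed.

(* Induction on the number of summands of the sum of the u_i (x) v_i: if v_1 is a
   combination of the other v_i, the first summand is absorbed by the others;
   otherwise a functional with value 1 at v_1 vanishing at the others gives
   u_1 = 0. *)
Lemma ev_tpair_eq0 (U V : lmodType k) (s : seq (U * V)) :
  (forall g : dual V, ev_list (fun u v => (g v : k) *: u) s = 0) ->
  ev_list (@tpair k U V) s = 0.
Proof.
(* The size is only bounded by [n], as the list after absorption is not a tail of [s]. *)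
move: {2}(size s) (leqnn (size s)) => n; elim: n s => [|n IHn] [|[u v] s] //=.
- by rewrite /ev_list big_nil.
- by rewrite /ev_list big_nil.
rewrite ltnS => le_sn sl0.
have [vs|vNs] := pselect (lspan [seq p.2 | p <- s] v).
  have [s' [sz fs']] := ev_list_absorb u vs.
  rewrite /ev_list big_cons /= -/(ev_list _ s) fs'; apply: IHn; first by rewrite sz.
  move=> g; rewrite -(sl0 g) /ev_list big_cons -/(ev_list _ s).
  pose f : {bilinear U -> V -> U} := HB.pack (fun u v => (g v : k) *: u)
    (bilinear_isBilinear.Build k U V U *:%R *:%R _ (slice_bilinear U g)).
  exact/esym/(fs' _ f).
have [g [g0 g1]] := functional_extending_subspace (lspan_subspace _) vNs.
have u0 : u = 0.
  rewrite -(sl0 g) /ev_list big_cons /= g1 scale1r big_seq big1 ?addr0 // => p ps.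
  by rewrite g0 ?scale0r //; apply/mem_lspan/map_f.
rewrite /ev_list big_cons /= u0 linear0l add0r; apply: IHn => // g'.
by rewrite -(sl0 g') /ev_list big_cons /= u0 scaler0 add0r.
Qed.

Lemma tens_slices_eq0 (U V : lmodType k) (x : tens U V) :
  (forall g : dual V, tlift x (fun u v => (g v : k) *: u) = 0) -> x = 0.
Proof. by move=> sl0; rewrite (tens_sum x); apply: ev_tpair_eq0. Qed.

(** Applying [f] to the slice of [x - y] by [g] gives the value of [f] (x) [g] at [x - y], so every
    slice vanishes. *)
Lemma dual_separates_tens (U V : lmodType k) (x y : tens U V) :
  (forall (f : dual U) (g : dual V),
    tlift x (fun u v => f u * g v : k^o) = tlift y (fun u v => f u * g v : k^o)) ->
  x = y.
Proof.
move=> fgxy; apply/eqP; rewrite -subr_eq0; apply/eqP/tens_slices_eq0 => g.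
apply: dual_separates => f; rewrite linear0.
have fgE t : f (tlift t (fun u v => (g v : k) *: u))
    = tlift t (fun u v => f u * g v : k^o).
  by rewrite linear_tlift; apply: eq_tlift => u v; rewrite linearZ mulrC.
rewrite fgE -[x - y]addrC -scaleN1r tlift_linear ?fgxy ?scaleN1r ?addNr //.
exact: prod_bilinear.
Qed.

Lemma dual_tlift (U V W : lmodType k) (x : tens U V) (F : U -> V -> dual W) w :
  tlift x F w = tlift x (fun u v => F u v w).
Proof. exact: (big_morph (fun f : dual W => f w)). Qed.

End Separation.

(** * The action on [C] and its axioms *)

Section Transpose.
Set Implicit Arguments.
Unset Strict Implicit.
Context (k : fieldType) (H : weakHopfType k) (C : coalgType k).
Context (ract : {linear tens (dual C) H -> dual C}).

Definition transposes (act : {linear tens H C -> C}) : Prop :=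
  forall (alpha : dual C) (h : H) (c : C),
    ract (alpha \ox h) c = alpha (act (h \ox c)).

Lemma transposes_exists :
  acts_by_transposes ract -> exists act, transposes act.
Proof.
move=> htr; pose d h c := projT1 (cid (htr h c)).
have dP h c (alpha : dual C) : ract (alpha \ox h) c = alpha (d h c).
  by rewrite /d; case: cid.
(* Tested against [alpha], linearity in [h] is that of [ract], and linearity in [c] is that of the
   functional [ract (alpha \ox h)]. *)
have d_bil : bilinear_for *:%R *:%R d.
  split=> [c a h l|h a c c']; apply: dual_separates => alpha.
    by rewrite linearP -!dP linearPr linearP.
  by rewrite linearP -!dP linearP.
pose act : {linear tens H C -> C} := HB.pack (fun t : tens H C => tlift t d)
  (GRing.isLinear.Build k _ C *:%R _ (tlift_linear d_bil)).
exists act.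
by move=> alpha h c; rewrite dP /= tlift_pair.
Qed.

Context (act : {linear tens H C -> C}) (actP : transposes act).

Lemma transposes_partial_module_coalgebra :
  right_partial_module_algebra ract -> left_partial_module_coalgebra act.
Proof.
case=> ract1 ractM ractA; split=> [c|h c|h l c].
- by apply: dual_separates => alpha; rewrite -actP ract1.
- apply: dual_separates_tens => f g.
  (* The convolution [f ** g] is, by definition, [f] (x) [g] composed with [comul]. *)
  rewrite -[LHS]/((f ** g) (act (h \ox c))) -actP ractM dual_tlift.
  (* [f] (x) [g] is bundled as a linear map to pass through both Sweedler sums. *)
  pose F := fun t : tens C C => tlift t (fun u v => f u * g v : k^o).
  have FL : linear F := tlift_linear (prod_bilinear f g).
  pose Fl : {linear tens C C -> k^o} :=
    HB.pack F (GRing.isLinear.Build k _ k^o *:%R F FL).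
  rewrite -[RHS]/(Fl _) linear_tlift; apply: eq_tlift => h1 h2.
  rewrite linear_tlift; apply: eq_tlift => c1 c2 /=.
  rewrite /F tlift_pair ?actP //; exact: prod_bilinear.
- apply: dual_separates => alpha.
  (* Transposition reverses the order: [alpha] at [h . (l . c)] is [(alpha <- h) <- l] at [c]. The
     unit of [dual C] is [counit], so [aone <- l2] at [c2] is the counit of [l2 . c2]. *)
  rewrite -!actP ractA dual_tlift linear_tlift; apply: eq_tlift => l1 l2.
  rewrite linear_tlift; apply: eq_tlift => c1 c2.
  by rewrite linearZ !actP mulrC.
Qed.

Lemma transposes_symmetric_partial_module_coalgebra :
  symmetric_right_partial_module_algebra ract ->
  symmetric_left_partial_module_coalgebra act.
Proof.
case=> hract ractS; split; first exact: transposes_partial_module_coalgebra.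
move=> h l c; apply: dual_separates => alpha.
rewrite -!actP ractS dual_tlift linear_tlift; apply: eq_tlift => l1 l2.
rewrite linear_tlift; apply: eq_tlift => c1 c2.
by rewrite linearZ !actP.
Qed.

End Transpose.

Theorem mainTheorem3 (k : fieldType) (H : weakHopfType k) (C : coalgType k)
    (ract : {linear tens (dual C) H -> dual C})
    (hract : right_partial_module_algebra ract)
    (htr : acts_by_transposes ract) :
  exists act : {linear tens H C -> C},
    [/\ left_partial_module_coalgebra act,
        forall (alpha : dual C) (h : H) (c : C),
          ract (alpha \ox h) c = alpha (act (h \ox c))
      & symmetric_right_partial_module_algebra ract ->
        symmetric_left_partial_module_coalgebra act].
Proof.
have [act actP] := transposes_exists htr.
exists act; split=> //; first exact: transposes_partial_module_coalgebra hract.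
exact: transposes_symmetric_partial_module_coalgebra.
Qed.
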